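(* Let $n\ge 1$, let $\mathcal{A}\subseteq\mathfrak{su}(2^n)$, let $\mathfrak{g}=\langle\mathcal{A}\rangle_{\mathrm{Lie},\mathbb{R}}$, and let $S\le S_n$ be a subgroup. If $\pi(A)=A$ for all $A\in\mathcal{A}$ and all $\pi\in S$, then $$\dim(\mathfrak{g})\le|\mathcal{P}_n/S|-1,$$ where $|\mathcal{P}_n/S|$ is the number of orbits of the set $\mathcal{P}_n$ of $n$-qubit Pauli strings under the action of $S$.
   Context: $\mathfrak{su}(N)=\{H\in\mathbb{C}^{N\times N}: H^\dagger=-H,\ \mathrm{tr}(H)=0\}$. $\langle\mathcal{A}\rangle_{\mathrm{Lie},\mathbb{R}}$ is the real Lie algebra with bracket $[A,B]=AB-BA$ generated by $\mathcal{A}$. $\mathcal{P}_n$ is the set of the $4^n$ Pauli strings $P=P_1\otimes\cdots\otimes P_n$ with $P_j\in\{I,X,Y,Z\}$ ($I$ the $2\times2$ identity, $X,Y,Z$ the Pauli matrices). A permutation $\pi\in S_n$ acts on Pauli strings by $\pi(P_1\otimes\cdots\otimes P_n)=P_{\pi(1)}\otimes\cdots\otimes P_{\pi(n)}$, extended linearly to all $2^n\times 2^n$ matrices. *)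

(* Defs.v *)
From HB Require Import structures.
From mathcomp Require Import all_boot all_fingroup all_order all_algebra.
From mathcomp Require Import complex mxtens.
From mathcomp Require Import boolp classical_sets reals.

Set Implicit Arguments.
Unset Strict Implicit.
Unset Printing Implicit Defensive.

Import Order.TTheory GRing.Theory Num.Theory.

Local Open Scope ring_scope.
Local Open Scope complex_scope.
Local Open Scope sesquilinear_scope.

Definition su (R : realType) (N : nat) : set 'M[R[i]]_N :=
  [set H | H^t* = - H /\ \tr H = 0]%classic.
Arguments su : clear implicits.

(* The canonical vector space structure of 'M[R[i]]_N is over R[i]; glR R N is
   the same type viewed as a vector space over R, so that \dim is the real
   dimension. *)
Definition glR (R : realType) (N : nat) : Type := 'M[R[i]]_N.

Section RealScalars.
Variables (R : realType) (N : nat).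

HB.instance Definition _ := GRing.Zmodule.copy (glR R N) 'M[R[i]]_N.

Definition glR_scale (a : R) (x : glR R N) : glR R N :=
  (a%:C *: (x : 'M[R[i]]_N))%R.

Fact glR_scaleA a b x : glR_scale a (glR_scale b x) = glR_scale (a * b) x.
Proof. by rewrite /glR_scale scalerA rmorphM. Qed.
Fact glR_scale1 : left_id 1 glR_scale.
Proof. by move=> x; rewrite /glR_scale scale1r. Qed.
Fact glR_scaleDr : right_distributive glR_scale +%R.
Proof. by move=> a x y; rewrite /glR_scale scalerDr. Qed.
Fact glR_scaleDl x : {morph glR_scale^~ x : a b / a + b}.
Proof. by move=> a b; rewrite /glR_scale rmorphD scalerDl. Qed.

HB.instance Definition _ := GRing.Zmodule_isLmodule.Build R (glR R N)
  glR_scaleA glR_scale1 glR_scaleDr glR_scaleDl.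

Fact glR_vect_iso : Vector.axiom (N * N + N * N) (glR R N).
Proof.
exists (fun x : glR R N => row_mx (mxvec (map_mx (@complex.Re R) (x : 'M[R[i]]_N)))
                                  (mxvec (map_mx (@complex.Im R) (x : 'M[R[i]]_N)))).
  move=> a x y; rewrite scale_row_mx add_row_mx -!linearP /=.
  congr (row_mx (mxvec _) (mxvec _)); apply/matrixP=> i j; rewrite !mxE /=;
    by case: (x i j) => p q; case: (y i j) => p' q' /=; rewrite mul0r ?subr0 ?addr0.
exists (fun v => \matrix_(i, j) ((vec_mx (lsubmx v)) i j +i*
                                 (vec_mx (rsubmx v)) i j)).
  move=> x; apply/matrixP=> i j.
  by rewrite mxE row_mxKl row_mxKr !mxvecK !mxE; case: (x i j).
move=> v; rewrite -[RHS]hsubmxK; congr row_mx; rewrite -[RHS]vec_mxK;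
  by congr mxvec; apply/matrixP=> i j; rewrite !mxE.
Qed.

HB.instance Definition _ := Lmodule_hasFinDim.Build R (glR R N) glR_vect_iso.

End RealScalars.

Definition bracket (R : realType) (N : nat) (x y : 'M[R[i]]_N) : glR R N :=
  x *m y - y *m x.

Definition is_lie_subalgebra (R : realType) (N : nat) (L : {vspace glR R N}) :=
  forall x y : glR R N, x \in L -> y \in L -> bracket x y \in L.

Lemma lie_gen_exists (R : realType) (N : nat) (A : set (glR R N)) :
  exists g : {vspace glR R N},
    [/\ forall x, A x -> x \in g, is_lie_subalgebra g
      & forall L : {vspace glR R N}, (forall x, A x -> x \in L) ->
          is_lie_subalgebra L -> (g <= L)%VS].
Proof.
pose good (L : {vspace glR R N}) := (forall x, A x -> x \in L) /\ is_lie_subalgebra L.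
have ex : exists k, `[< exists2 L, good L & \dim L = k >].
  exists (\dim {: glR R N}); apply/asboolP; exists fullv => //.
  by split=> [x _|x y _ _]; rewrite memvf.
case: (ex_minnP ex) => k /asboolP[g [gA gL] <-] gmin.
exists g; split=> // L LA LL; apply/capv_idPl/eqP.
rewrite eqEdim capvSl; apply: gmin; apply/asboolP; exists (g :&: L)%VS => //.
split=> [x Ax|x y]; first by rewrite memv_cap gA ?LA.
rewrite !memv_cap => /andP[xg xL] /andP[yg yL].
by apply/andP; split; [exact: gL | exact: LL].
Qed.

(* The real Lie algebra generated by A: the least real Lie subalgebra that
   contains A. *)
Definition lie_gen (R : realType) (N : nat) (A : set 'M[R[i]]_N) :
    {vspace glR R N} :=
  sval (cid (@lie_gen_exists R N A)).

Lemma lie_genP (R : realType) (N : nat) (A : set 'M[R[i]]_N) :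
  [/\ forall x, A x -> x \in lie_gen A, is_lie_subalgebra (lie_gen A)
    & forall L : {vspace glR R N}, (forall x, A x -> x \in L) ->
        is_lie_subalgebra L -> (lie_gen A <= L)%VS].
Proof. exact: svalP (cid (@lie_gen_exists R N A)). Qed.

Inductive pauli := PauliI | PauliX | PauliY | PauliZ.

Definition ord_of_pauli (p : pauli) : 'I_4 :=
  match p with
  | PauliI => inord 0 | PauliX => inord 1 | PauliY => inord 2 | PauliZ => inord 3
  end.
Definition pauli_of_ord (k : 'I_4) : pauli :=
  nth PauliI [:: PauliI; PauliX; PauliY; PauliZ] k.
Fact ord_of_pauliK : cancel ord_of_pauli pauli_of_ord.
Proof. by case; rewrite /pauli_of_ord /= inordK. Qed.
HB.instance Definition _ := Finite.copy pauli (can_type ord_of_pauliK).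

(* Strings are formal words here; pauli_string_mx below maps them injectively
   to matrices. *)
Definition pauli_string (n : nat) := {ffun 'I_n -> pauli}.
HB.instance Definition _ n := Finite.on (pauli_string n).

Definition pauli_perm (n : nat) (pi : 'S_n) (P : pauli_string n) :
  pauli_string n := [ffun j => P (pi j)].

Definition pauli_orbits (n : nat) (S : {group 'S_n}) :
    {set {set pauli_string n}} :=
  [set [set pauli_perm pi P | pi in S] | P in [set: pauli_string n]]%SET.

Section PauliMatrices.
Variable R : realType.

Definition pauli_mx (p : pauli) : 'M[R[i]]_(1 + 1) :=
  match p with
  | PauliI => 1%:M
  | PauliX => block_mx 0         1%:M  1%:M    0
  | PauliY => block_mx 0 (- 'i)%:M  'i%:M      0
  | PauliZ => block_mx 1%:M      0     0  (-1)%:M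
  end.

Fixpoint tensor (n : nat) : ('I_n -> 'M[R[i]]_2) -> 'M[R[i]]_(2 ^ n) :=
  match n with
  | 0 => fun=> 1%:M
  | m.+1 => fun F =>
      castmx (esym (expnS 2 m), esym (expnS 2 m))
        (F ord0 *t tensor (fun j : 'I_m => F (lift ord0 j)))
  end.

Definition pauli_string_mx (n : nat) (P : pauli_string n) : 'M[R[i]]_(2 ^ n) :=
  tensor (fun j => pauli_mx (P j)).

Definition pauli_tuple (n : nat) :
    #|pauli_string n|.-tuple 'M[R[i]]_(2 ^ n) :=
  [tuple pauli_string_mx (enum_val k) | k < #|pauli_string n|].

Lemma mxtrace_tens m p (M : 'M[R[i]]_m) (Q : 'M[R[i]]_p) :
  \tr (M *t Q) = \tr M * \tr Q.
Proof. by rewrite /mxtrace mulr_sum; apply: eq_bigr => k _; rewrite mxE. Qed.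

Lemma mxtrace_castmx m p (e : m = p) (M : 'M[R[i]]_m) :
  \tr (castmx (e, e) M) = \tr M.
Proof. by case: p / e; rewrite castmx_id. Qed.

Lemma mulmx_castmx m p (e : m = p) (M Q : 'M[R[i]]_m) :
  castmx (e, e) M *m castmx (e, e) Q = castmx (e, e) (M *m Q).
Proof. by case: p / e; rewrite !castmx_id. Qed.

Lemma tensor_mul n (F G : 'I_n -> 'M[R[i]]_2) :
  tensor F *m tensor G = tensor (fun j => F j *m G j).
Proof.
elim: n F G => [|n IHn] F G /=; first by rewrite mul1mx.
by rewrite mulmx_castmx tensmx_mul IHn.
Qed.

Lemma mxtrace_tensor n (F : 'I_n -> 'M[R[i]]_2) :
  \tr (tensor F) = \prod_j \tr (F j).
Proof.
elim: n F => [|n IHn] F /=; first by rewrite big_ord0 mxtrace1.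
by rewrite mxtrace_castmx mxtrace_tens IHn big_ord_recl.
Qed.

Lemma mxtrace_pauli_mul p q :
  \tr (pauli_mx p *m pauli_mx q) = (p == q)%:R *+ 2.
Proof.
have -> : (p == q) = (ord_of_pauli p == ord_of_pauli q).
  by rewrite (can_eq ord_of_pauliK).
rewrite -val_eqE; case: p; case: q; rewrite /= !inordK //=;
  rewrite ?mul1mx ?mulmx1 ?mulmx_block ?mxtrace1 ?mxtrace_block
    ?mulmx0 ?mul0mx ?mulmx1 ?mul1mx ?addr0 ?add0r
    ?mul_scalar_mx ?scale_scalar_mx ?mxtrace0 ?mxtrace_scalar ?mxtrace1 ?mulr1n
    ?mul0rn ?addr0 ?subrr ?addNr ?mulrNN ?mulr1 //.
have ii : 'i * 'i = -1 :> R[i].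
  by apply/eqP; rewrite eq_complex /= !mul0r !mulr0 mulr1 addr0 sub0r oppr0 !eqxx.
by rewrite mulNr mulrN ii opprK.
Qed.

Lemma mxtrace_pauli_string_mul n (P Q : pauli_string n) :
  \tr (pauli_string_mx P *m pauli_string_mx Q) = (P == Q)%:R * 2 ^+ n.
Proof.
rewrite tensor_mul mxtrace_tensor.
under eq_bigr do rewrite mxtrace_pauli_mul.
have [->|/eqP neqPQ] := eqVneq P Q.
  by under eq_bigr do rewrite eqxx; rewrite prodr_const card_ord mul1r.
have [j] : exists j, P j != Q j.
  case: (boolP [exists j, P j != Q j]) => [/existsP //|].
  rewrite negb_exists => /forallP eqPQ.
  by case: neqPQ; apply/ffunP => j; apply/eqP; rewrite -[_ == _]negbK eqPQ.
by move=> /negbTE neqj; rewrite (bigD1 j) //= neqj mul0rn !mul0r.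
Qed.

Lemma pauli_string_mx_inj n : injective (@pauli_string_mx n).
Proof.
move=> P Q eqPQ; apply/eqP; have := mxtrace_pauli_string_mul P Q.
rewrite -eqPQ mxtrace_pauli_string_mul eqxx mul1r; case: (P == Q) => // /eqP.
by rewrite mul0r expf_eq0 pnatr_eq0 andbF.
Qed.

Lemma nth_pauli_tuple n (k : 'I_#|pauli_string n|) :
  (pauli_tuple n)`_k = pauli_string_mx (enum_val k).
Proof. by rewrite -tnth_nth tnth_mktuple. Qed.

Lemma pauli_tuple_free n : free (pauli_tuple n).
Proof.
apply/freeP => c c0 k.
have /(congr1 (fun M => \tr (M *m pauli_string_mx (enum_val k)))) := c0.
rewrite mul0mx mxtrace0 mulmx_suml raddf_sum /= (bigD1 k) //= big1 => [|l lk].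
  rewrite addr0 nth_pauli_tuple -scalemxAl mxtraceZ mxtrace_pauli_string_mul eqxx.
  by move=> /eqP; rewrite mul1r mulf_eq0 expf_eq0 pnatr_eq0 andbF orbF => /eqP.
rewrite nth_pauli_tuple -scalemxAl mxtraceZ mxtrace_pauli_string_mul.
by rewrite (inj_eq enum_val_inj) (negbTE lk) mul0r mulr0.
Qed.

Lemma card_pauli : #|{: pauli}| = 4%N.
Proof.
rewrite -[RHS]card_ord; apply: (@bij_eq_card _ _ ord_of_pauli).
exists pauli_of_ord; first exact: ord_of_pauliK.
by case=> -[|[|[|[]]]] // lt4; apply: val_inj; rewrite /= inordK.
Qed.

Lemma pauli_tuple_basis n : basis_of fullv (pauli_tuple n).
Proof.
rewrite basisEfree pauli_tuple_free subvf /= dimvf size_tuple.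
rewrite card_ffun card_pauli !card_ord dim_matrix.
by rewrite -[leqLHS]/(2 ^ n * 2 ^ n)%N -expnMn.
Qed.

(* The R[i]-linear extension of P |-> pauli_perm pi P to all matrices, through
   coordinates in the basis of Pauli strings. *)
Definition perm_act (n : nat) (pi : 'S_n) (M : 'M[R[i]]_(2 ^ n)) :
    'M[R[i]]_(2 ^ n) :=
  \sum_(k < #|pauli_string n|)
     coord (pauli_tuple n) k M *:
       pauli_string_mx (pauli_perm pi (enum_val k)).

Lemma perm_act_pauli n (pi : 'S_n) (P : pauli_string n) :
  perm_act pi (pauli_string_mx P) = pauli_string_mx (pauli_perm pi P).
Proof.
rewrite -(enum_rankK P); move: (enum_rank P) => k0.
rewrite -nth_pauli_tuple /perm_act (bigD1 k0) //= big1 => [|k kk0].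
  by rewrite coord_free ?pauli_tuple_free // eqxx scale1r addr0.
by rewrite coord_free ?pauli_tuple_free // eq_sym (negbTE kk0) scale0r.
Qed.

Lemma perm_act_is_linear n (pi : 'S_n) : linear (@perm_act n pi).
Proof.
move=> a M Q; rewrite /perm_act scaler_sumr -big_split /=; apply: eq_bigr => k _.
by rewrite linearP scalerDl scalerA.
Qed.

End PauliMatrices.

(* Main.v *)
(** A matrix [M] is determined by its Pauli coefficients [tr (M P)], and it is
    fixed by [S] exactly when these are constant on the [S]-orbits of Pauli
    strings.  They are imaginary when [M] is anti-Hermitian, and the coefficient
    of the identity string vanishes when [M] is traceless; hence the real vector
    space of the [S]-invariant elements of [su(2^n)] embeds into the real
    functions on the orbits other than that of the identity.  This space is
    closed under brackets because [tr (P Q W)] factors over the tensor slots and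
    is therefore unchanged when [P], [Q], [W] are permuted simultaneously. *)
From HB Require Import structures.
Require Import Defs.
From mathcomp Require Import all_boot all_fingroup all_order all_algebra.
From mathcomp Require Import complex mxtens boolp classical_sets reals.

Set Implicit Arguments.
Unset Strict Implicit.
Unset Printing Implicit Defensive.

Import GRing.Theory Num.Theory.

Local Open Scope ring_scope.
Local Open Scope complex_scope.
Local Open Scope sesquilinear_scope.

(** A subspace of maximal dimension inside [P] works: adjoining a vector of [P] to it stays inside
    [P], so by maximality adds nothing. *)
Lemma vspace_of_submod_closed (K : fieldType) (V : vectType K) (P : V -> Prop) :
    P 0 -> (forall a x y, P x -> P y -> P (a *: x + y)) ->
  exists U : {vspace V}, forall x, x \in U <-> P x.
Proof.
move=> P0 Plin.
pose dim_in k := `[< exists2 U : {vspace V}, (forall x, x \in U -> P x) & \dim U = k >].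
have ex : exists k, dim_in k.
  exists 0%N; apply/asboolP; exists 0%VS; last by rewrite dimv0.
  by move=> x; rewrite memv0 => /eqP ->.
have ub k : dim_in k -> (k <= \dim {: V})%N.
  by move=> /asboolP[U _ <-]; rewrite dimvS ?subvf.
case: (ex_maxnP ex ub) => k /asboolP[U UP <-] Umax.
exists U => x; split=> [|Px]; first exact: UP.
suff /eqP -> : U == (<[x]> + U)%VS by rewrite memvE addvSl.
rewrite eqEdim addvSr Umax //; apply/asboolP; exists (<[x]> + U)%VS => // z.
by case/memv_addP=> _ /vlineP[a ->] [y /UP Py ->]; apply: Plin.
Qed.

Section PauliStringPermutations.
Variable n : nat.
Implicit Types (pi : 'S_n) (P Q W : pauli_string n).

Lemma pauli_perm_inj pi : injective (pauli_perm pi).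
Proof.
move=> P Q /ffunP eqPQ; apply/ffunP=> j.
by have := eqPQ (pi^-1%g j); rewrite !ffunE permKV.
Qed.

Lemma pauli_perm1 P : pauli_perm 1 P = P.
Proof. by apply/ffunP=> j; rewrite ffunE perm1. Qed.

Definition pauli_id : pauli_string n := [ffun=> PauliI].

(** All letters of the identity string agree, so moving slots changes nothing; this orbit is the one
    subtracted in the bound. *)
Lemma pauli_orbit_id (S : {group 'S_n}) :
  [set pauli_perm pi pauli_id | pi in S] = [set pauli_id].
Proof.
apply/setP=> P; rewrite inE; apply/imsetP/eqP=> [[pi _ ->]|->].
  by apply/ffunP=> j; rewrite !ffunE.
by exists 1%g; rewrite ?pauli_perm1.
Qed.

End PauliStringPermutations.

Section PauliCoefficients.
Variable R : realType.

Lemma pauli_mx_hermitian (p : pauli) : (pauli_mx R p)^t* = pauli_mx R p.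
Proof.
case: p; rewrite /pauli_mx ?tr_block_mx ?map_block_mx ?tr_scalar_mx ?trmx0.
all: rewrite ?raddfN /= ?tr_scalar_mx ?map_scalar_mx ?raddf0 ?raddfN /=.
all: by rewrite ?map_scalar_mx ?rmorph1 ?rmorphN ?rmorph1 ?conjCi ?raddfN ?opprK.
Qed.

Lemma tensmx11 m p : (1%:M : 'M[R[i]]_m) *t (1%:M : 'M[R[i]]_p) = 1%:M.
Proof.
apply/matrixP=> k l; case: (mxtens_indexP k) => k0 k1; case: (mxtens_indexP l) => l0 l1.
rewrite tensmxE !mxE (can_eq (@mxtens_indexK _ _)) xpair_eqE.
by case: (k0 == l0); rewrite ?mul1r ?mul0r.
Qed.

Lemma tensor_hermitian n (F : 'I_n -> 'M[R[i]]_2) :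
  (forall j, (F j)^t* = F j) -> (tensor F)^t* = tensor F.
Proof.
elim: n F => [|n IHn] F hF /=; first by rewrite tr_scalar_mx map_scalar_mx rmorph1.
by rewrite trmx_cast map_castmx trmx_tens map_mxT hF IHn.
Qed.

Lemma tensor1 n (F : 'I_n -> 'M[R[i]]_2) :
  (forall j, F j = 1%:M) -> tensor F = 1%:M.
Proof.
elim: n F => [|n IHn] F hF //=.
rewrite hF IHn // tensmx11.
by case: _ / (esym (expnS 2 n)); rewrite !castmx_id.
Qed.

Variable n : nat.
Implicit Types (pi : 'S_n) (P Q W : pauli_string n) (M N : 'M[R[i]]_(2 ^ n)).

Local Notation smx := (@pauli_string_mx R n).

(** By orthogonality of the strings, this is 2^n times the coordinate of [M] along [P]; the trace
    form suits adjoints and products. *)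
Definition pauli_coef M P : R[i] := \tr (M *m smx P).

Lemma pauli_coef_sum (c : pauli_string n -> R[i]) Q :
  pauli_coef (\sum_P c P *: smx P) Q = c Q * 2 ^+ n.
Proof.
rewrite /pauli_coef mulmx_suml raddf_sum (bigD1 Q) //= big1 => [|P nPQ].
  by rewrite addr0 -scalemxAl mxtraceZ mxtrace_pauli_string_mul eqxx mul1r.
by rewrite -scalemxAl mxtraceZ mxtrace_pauli_string_mul (negbTE nPQ) mul0r mulr0.
Qed.

Lemma pauli_expand M : M = \sum_P (pauli_coef M P / 2 ^+ n) *: smx P.
Proof.
pose c P := coord (pauli_tuple R n) (enum_rank P) M.
have eM : M = \sum_P c P *: smx P.
  have /coord_span {1}-> : M \in <<pauli_tuple R n>>%VS.
    by rewrite (span_basis (pauli_tuple_basis R n)) memvf.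
  rewrite [RHS](reindex _ (onW_bij _ (enum_val_bij _))) /=.
  by apply: eq_bigr => k _; rewrite nth_pauli_tuple /c enum_valK.
rewrite {1}eM; apply: eq_bigr => P _; rewrite eM pauli_coef_sum mulfK //.
by rewrite expf_neq0 // pnatr_eq0.
Qed.

(** Turns [perm_act pi M = M] into a condition on coefficients. As [pauli_perm pi] is injective,
    orthogonality leaves only the term [P = W]. *)
Lemma pauli_coef_perm_act pi M W :
  pauli_coef (perm_act pi M) (pauli_perm pi W) = pauli_coef M W.
Proof.
pose act := GRing.isLinear.Build _ _ _ _ _ (@perm_act_is_linear R n pi).
pose act_lin : {linear _ -> _} := HB.pack (@perm_act R n pi) act.
have -> : perm_act pi M = \sum_P (pauli_coef M P / 2 ^+ n) *: smx (pauli_perm pi P).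
  rewrite {1}(pauli_expand M) -[LHS]/(act_lin _) linear_sum.
  by apply: eq_bigr => P _; rewrite linearZ /= perm_act_pauli.
rewrite {2}(pauli_expand M) pauli_coef_sum.
rewrite /pauli_coef mulmx_suml raddf_sum (bigD1 W) //= big1 => [|P nPW].
  by rewrite addr0 -scalemxAl mxtraceZ mxtrace_pauli_string_mul eqxx mul1r.
rewrite -scalemxAl mxtraceZ mxtrace_pauli_string_mul.
by rewrite (inj_eq (@pauli_perm_inj n pi)) (negbTE nPW) mul0r mulr0.
Qed.

Lemma mxtrace_pauli_perm pi P Q W :
  \tr (smx (pauli_perm pi P) *m smx (pauli_perm pi Q) *m smx (pauli_perm pi W))
  = \tr (smx P *m smx Q *m smx W).
Proof.
rewrite !tensor_mul !mxtrace_tensor [RHS](reindex_inj (@perm_inj _ pi)).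
by apply: eq_bigr => j _; rewrite !ffunE.
Qed.

Definition pauli_coef_invariant pi M :=
  forall W, pauli_coef M (pauli_perm pi W) = pauli_coef M W.

Lemma pauli_coef_mul M N W :
  pauli_coef (M *m N) W = \sum_P \sum_Q
    (pauli_coef M P / 2 ^+ n) * (pauli_coef N Q / 2 ^+ n) *
    \tr (smx P *m smx Q *m smx W).
Proof.
rewrite {1}/pauli_coef {1}(pauli_expand M) !mulmx_suml raddf_sum.
apply: eq_bigr => P _; rewrite {1}(pauli_expand N) mulmx_sumr mulmx_suml raddf_sum.
apply: eq_bigr => Q _.
by rewrite /= -!scalemxAl -scalemxAr -scalemxAl !mxtraceZ mulrA.
Qed.

(** Reindexing both sums of [pauli_coef_mul] by [pauli_perm pi] changes neither the coefficients nor
    the triple traces. *)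
Lemma pauli_coef_invariant_mul pi M N :
    pauli_coef_invariant pi M -> pauli_coef_invariant pi N ->
  pauli_coef_invariant pi (M *m N).
Proof.
move=> invM invN W; rewrite !pauli_coef_mul (reindex_inj (@pauli_perm_inj n pi)).
apply: eq_bigr => P _; rewrite (reindex_inj (@pauli_perm_inj n pi)).
by apply: eq_bigr => Q _; rewrite invM invN mxtrace_pauli_perm.
Qed.

Lemma pauli_coefP (a : R[i]) M N W :
  pauli_coef (a *: M + N) W = a * pauli_coef M W + pauli_coef N W.
Proof. by rewrite /pauli_coef mulmxDl -scalemxAl mxtraceD mxtraceZ. Qed.

Lemma pauli_coef_id M : pauli_coef M (pauli_id n) = \tr M.
Proof.
by rewrite /pauli_coef /pauli_string_mx tensor1 ?mulmx1 // => j; rewrite ffunE.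
Qed.

(** Pauli strings are Hermitian, so conjugating tr(MW) gives tr(W(-M)) = -tr(MW); the real part
    equals its own negative. *)
Lemma Re_pauli_coef M W : M^t* = - M -> complex.Re (pauli_coef M W) = 0.
Proof.
move=> skewM; have cj : (pauli_coef M W)^* = - pauli_coef M W.
  have herm : (smx W)^t* = smx W.
    by apply: tensor_hermitian => j; exact: pauli_mx_hermitian.
  rewrite /pauli_coef -[in LHS]mxtrace_tr -trace_map_mx trmx_mul map_mxM herm skewM.
  by rewrite mulmxN raddfN /= mxtrace_mulC.
move: cj; case: (pauli_coef M W) => p q /= [/eqP].
by rewrite -addr_eq0 -mulr2n mulrn_eq0 => /eqP.
Qed.

End PauliCoefficients.

Theorem theorem2 (R : realType) (n : nat) (hn : (1 <= n)%N)
    (A : set 'M[R[i]]_(2 ^ n)) (hA : (A `<=` su R (2 ^ n))%classic)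
    (S : {group 'S_n})
    (hS : forall (M : 'M[R[i]]_(2 ^ n)) (pi : 'S_n),
        A M -> pi \in S -> perm_act pi M = M) :
  (\dim (lie_gen A) <= #|pauli_orbits S| - 1)%N.
Proof.
pose inv_su (M : glR R (2 ^ n)) := su R (2 ^ n) M /\
  forall pi, pi \in S -> pauli_coef_invariant pi M.
have inv_su0 : inv_su (0 : 'M[R[i]]_(2 ^ n)).
  split=> [|pi _ W]; last by rewrite /pauli_coef !mul0mx.
  by split; [rewrite trmx0 map_mx0 oppr0 | exact: mxtrace0].
have inv_suP (a : R) (x y : 'M[R[i]]_(2 ^ n)) :
    inv_su x -> inv_su y -> inv_su (a%:C *: x + y).
  move=> [[skx trx] invx] [[sky try] invy]; split; last first.
    by move=> pi piS W; rewrite !pauli_coefP invx ?invy.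
  split; last by rewrite mxtraceD mxtraceZ trx try mulr0 addr0.
  rewrite linearD linearZ /= map_mxD map_mxZ skx sky /= scalerN -opprD.
  (* A real scalar is its own conjugate; this is why the space is only a real one. *)
  by congr (- (_ *: _ + _)); apply/eqP; rewrite eq_complex /= oppr0 !eqxx.
have [L LP] := @vspace_of_submod_closed _ (glR R (2 ^ n)) _ inv_su0 inv_suP.
have lieL : is_lie_subalgebra L.
  move=> x y /LP[[skx trx] invx] /LP[[sky try] invy]; apply/LP; split; last first.
    move=> pi piS W.
    have sub M N : pauli_coef (M - N) =1 (fun W => pauli_coef M W - pauli_coef N W).
      by move=> V; rewrite /pauli_coef mulmxBl raddfB.
    by rewrite !sub !pauli_coef_invariant_mul //; auto.
  split; last by rewrite raddfB /= mxtrace_mulC subrr.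
  (* Adjoints reverse products and the two signs cancel: xy - yx goes to yx - xy. *)
  rewrite /bracket raddfB /= map_mxB !trmx_mul !map_mxM skx sky.
  by rewrite !mulNmx !mulmxN !opprK opprB.
(* By minimality of [lie_gen A], it suffices that the subalgebra [L] contains [A]; [hA] and [hS]
   give this. *)
have [_ _ /(_ L) genL] := lie_genP A.
have {genL} /dimvS/leq_trans -> // : (lie_gen A <= L)%VS.
  apply: genL => // M AM; apply/LP; split=> [|pi piS W]; first exact: hA.
  by rewrite -{1}(hS M pi) // pauli_coef_perm_act.
pose O0 := [set pauli_id n].
have O0_orbit : O0 \in pauli_orbits S.
  by rewrite /O0 -(pauli_orbit_id S); apply/imsetP; exists (pauli_id n).
pose orbits := pauli_orbits S :\ O0.
have -> : (#|pauli_orbits S| - 1 = #|orbits|)%N by rewrite (cardsD1 O0) O0_orbit addKn.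
(* The default is returned only for an empty set, and orbits are nonempty. *)
pose rep (O : {set pauli_string n}) := odflt (pauli_id n) [pick P in O].
pose f (M : glR R (2 ^ n)) : 'rV[R]_#|orbits| :=
  \row_k complex.Im (pauli_coef M (rep (enum_val k))).
have f_lin : linear f.
  move=> a x y; apply/rowP=> k; rewrite !mxE pauli_coefP.
  by case: (pauli_coef x _) (pauli_coef y _) => [p q] [p' q'] /=; rewrite mul0r addr0.
pose f_lin' := GRing.isLinear.Build _ _ _ _ _ f_lin.
pose fl : {linear _ -> _} := HB.pack f f_lin'.
(* Rank-nullity on [L]: with trivial kernel, its dimension is that of an image inside R^k, k the
   number of remaining orbits. *)
rewrite -(limg_ker_dim (linfun fl) L).
have -> : (L :&: lker (linfun fl) = 0)%VS.
  apply/eqP; rewrite -subv0; apply/subvP=> M; rewrite memv_cap memv_ker lfunE /=.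
  move=> /andP[/LP[[skM trM] invM] /eqP fM0]; rewrite memv0; apply/eqP.
  rewrite (pauli_expand M); apply: big1 => W _.
  suff -> : pauli_coef M W = 0 by rewrite mul0r scale0r.
  pose O := [set pauli_perm pi W | pi in S].
  have WO : W \in O by apply/imsetP; exists 1%g; rewrite ?group1 ?pauli_perm1.
  (* If the orbit of [W] is that of the identity, [W] is the identity string and its coefficient is
     the trace, hence 0. *)
  have [eO|nO] := eqVneq O O0.
    by move: WO; rewrite eO inE => /eqP ->; rewrite pauli_coef_id.
  have Oin : O \in orbits by rewrite !inE nO; apply/imsetP; exists W.
  have /imsetP[pi piS repE] : rep O \in O.
    by rewrite /rep; case: pickP => //= /(_ W); rewrite WO.
  (* Invariance moves the coefficient to the representative: its real part vanishes by skewness, its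
     imaginary part by [fM0]. *)
  rewrite -(invM pi piS W) -repE; have := Re_pauli_coef (rep O) skM.
  have /rowP/(_ (enum_rank_in Oin O)) := fM0; rewrite !mxE enum_rankK_in //.
  by case: (pauli_coef M _) => p q /= -> ->.
rewrite dimv0 add0n (leq_trans (dimvS (subvf _))) // dimvf.
by rewrite dim_matrix mul1r.
Qed.
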